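(* Let $G_1=([n],E_1)$ and $G_2=([n],E_2)$ be simple undirected graphs on $n$ vertices each, and let $cp\vartheta$ denote the optimal value of the completely positive program CP-LT associated with $(G_1,G_2)$. Then $cp\vartheta=n$ if and only if $G_1$ and $G_2$ are isomorphic. Moreover, in this case the feasible region of CP-LT (its elements viewed as $n^2\times n^2$ matrices by dropping the row and column indexed by $\omega$) is equal to $\mathcal{P}_{G_1,G_2}$.
   Context: $[n]=\{1,\dots,n\}$. Edges are unordered pairs of distinct vertices; $(i,k)\in E$ means that $\{i,k\}$ is an edge (so $(i,i)\notin E$). $G_1$ and $G_2$ are isomorphic if there is a bijection $\sigma:[n]\to[n]$ with $(\sigma(x),\sigma(y))\in E_2$ if and only if $(x,y)\in E_1$; such a $\sigma$ is called an isomorphism between $G_1$ and $G_2$. A real symmetric $m\times m$ matrix $M$ is completely positive (CP) if $M=QQ^T$ for some real $m\times k$ matrix $Q$ with all entries non-negative. The program CP-LT for $(G_1,G_2)$: the variable is a real symmetric $(n^2+1)\times(n^2+1)$ matrix $Y$ with rows and columns indexed by $\{ij \mid i,j\in[n]\}\cup\{\omega\}$. Maximize $\sum_{i,j\in[n]}Y_{ij,ij}$ subject to: $Y$ is completely positive; $Y_{\omega,\omega}=1$; $Y_{ij,\omega}=Y_{ij,ij}$ for all $i,j\in[n]$; $Y_{ij,ik}=0$ for all $i,j,k\in[n]$ with $j\neq k$; $Y_{ji,ki}=0$ for all $i,j,k\in[n]$ with $j\neq k$; $Y_{ij,kl}=0$ whenever $(i,k)\in E_1$ and $(j,l)\notin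 E_2$; $Y_{ij,kl}=0$ whenever $(i,k)\notin E_1$ and $(j,l)\in E_2$. The feasible region of CP-LT is the set of all matrices satisfying these constraints. Since the $\omega$ row and column of a feasible matrix are determined by its diagonal and $Y_{\omega,\omega}=1$, feasible matrices are identified with the $n^2\times n^2$ matrices obtained by dropping the $\omega$ row and column. For a permutation $\sigma\in S_n$, $P_\sigma$ is its permutation matrix ($[P_\sigma]_{ij}=1$ if $j=\sigma(i)$, and $0$ otherwise), and $P^{[2]}_\sigma$ is the $n^2\times n^2$ matrix with $[P^{[2]}_\sigma]_{ij,kl}=[P_\sigma]_{ij}[P_\sigma]_{kl}$. $\mathcal{P}_{G_1,G_2}$ is the convex hull of $\{P^{[2]}_\sigma \mid \sigma \text{ is an isomorphism between } G_1 \text{ and } G_2\}$.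
   Formalization: The ''Moreover'' clause is proved for the set of optimal feasible matrices (objective value n), not the whole feasible region: for n ≥ 1 the matrix whose only nonzero entry is Y_{ω,ω}=1 is feasible, has objective 0, and is not in P_{G1,G2} after dropping ω. *)

(* Defs.v *)
From mathcomp Require Import all_boot all_order all_fingroup all_algebra.
From mathcomp Require Import all_classical all_reals all_analysis.

Set Implicit Arguments.
Unset Strict Implicit.
Unset Printing Implicit Defensive.

Import Order.TTheory GRing.Theory Num.Theory.

Local Open Scope classical_set_scope.
Local Open Scope ring_scope.

(* A simple graph on the vertex set 'I_n is a symmetric irreflexive relation. *)
Definition graph_isomorphism (n : nat) (E1 E2 : rel 'I_n) (s : 'S_n) : Prop :=
  forall x y : 'I_n, E2 (s x) (s y) = E1 x y.

Definition graph_isomorphic (n : nat) (E1 E2 : rel 'I_n) : Prop :=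
  exists s : 'S_n, graph_isomorphism E1 E2 s.

Definition completely_positive (R : realType) (m : nat) (M : 'M[R]_m) : Prop :=
  M^T = M /\
  exists (k : nat) (Q : 'M[R]_(m, k)),
    (forall i j, 0 <= Q i j) /\ M = Q *m Q^T.

(* Rows and columns are indexed by {ij | i, j in [n]} + {omega}: the first
   n * n indices carry the pairs, the last one is omega. *)
Definition pair_idx (n : nat) (i j : 'I_n) : 'I_(n * n + 1) :=
  lshift 1 (mxvec_index i j).

Definition omega_idx (n : nat) : 'I_(n * n + 1) := rshift (n * n) ord0.

Definition drop_omega (R : realType) (n : nat) (Y : 'M[R]_(n * n + 1)) :
  'M[R]_(n * n) := ulsubmx Y.

(* A non-edge (i, k) may have i = k. *)
Record cplt_feasible (R : realType) (n : nat) (E1 E2 : rel 'I_n)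
    (Y : 'M[R]_(n * n + 1)) : Prop := CpltFeasible {
  cplt_cp : completely_positive Y;
  cplt_omega : Y (omega_idx n) (omega_idx n) = 1;
  cplt_diag : forall i j : 'I_n,
    Y (pair_idx i j) (omega_idx n) = Y (pair_idx i j) (pair_idx i j);
  cplt_row : forall i j k : 'I_n, j != k ->
    Y (pair_idx i j) (pair_idx i k) = 0;
  cplt_col : forall i j k : 'I_n, j != k ->
    Y (pair_idx j i) (pair_idx k i) = 0;
  cplt_edge : forall i j k l : 'I_n, E1 i k -> ~~ E2 j l ->
    Y (pair_idx i j) (pair_idx k l) = 0;
  cplt_nonedge : forall i j k l : 'I_n, ~~ E1 i k -> E2 j l ->
    Y (pair_idx i j) (pair_idx k l) = 0
}.

Definition cplt_objective (R : realType) (n : nat) (Y : 'M[R]_(n * n + 1)) : R :=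
  \sum_(i < n) \sum_(j < n) Y (pair_idx i j) (pair_idx i j).

Definition cptheta (R : realType) (n : nat) (E1 E2 : rel 'I_n) : \bar R :=
  ereal_sup [set (cplt_objective Y)%:E
            | Y in [set Y : 'M[R]_(n * n + 1) | cplt_feasible E1 E2 Y]].

(* The matrix whose only nonzero entry is a 1 at (omega, omega) satisfies all
   the constraints, so for n > 0 the whole feasible region always contains a
   point of objective value 0; the convex hull of the P^[2]_sigma, on which the
   objective is constantly n, can only be compared with the part of the
   feasible region that attains the optimal value. *)
Definition cplt_optimal (R : realType) (n : nat) (E1 E2 : rel 'I_n) :
    set 'M[R]_(n * n + 1) :=
  [set Y | cplt_feasible E1 E2 Y /\ (cplt_objective Y)%:E = cptheta R E1 E2].

Arguments cplt_optimal R {n} E1 E2 _.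

(* [P2_sigma]_(ij, kl) = [P_sigma]_ij [P_sigma]_kl, where
   mxvec P 0 (mxvec_index i j) = P i j and perm_mx s i j = (s i == j)%:R. *)
Definition perm_mx2 (R : realType) (n : nat) (s : 'S_n) : 'M[R]_(n * n) :=
  \matrix_(a, b) (mxvec (perm_mx s : 'M[R]_n) 0 a
                  * mxvec (perm_mx s : 'M[R]_n) 0 b).

Definition convex_hull (R : realType) (V : lmodType R) (A : set V) : set V :=
  [set x | exists (k : nat) (v : 'I_k -> V) (w : 'I_k -> R),
     [/\ forall i, A (v i), forall i, 0 <= w i, \sum_(i < k) w i = 1
       & x = \sum_(i < k) w i *: v i]].

Definition iso_polytope (R : realType) (n : nat) (E1 E2 : rel 'I_n) :
    set 'M[R]_(n * n) :=
  convex_hull [set perm_mx2 R s | s in [set s | graph_isomorphism E1 E2 s]].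

Arguments iso_polytope R {n} E1 E2 _.

(* Main.v *)
(* Write Y = Q Q^T with Q >= 0.  Each column t of Q consists of entries u_t(ij)
   and an entry c_t at omega, with sum_t c_t^2 = 1, and since Q >= 0 the zero
   constraints on Y force the support S_t of u_t to be the graph of a partial
   isomorphism, so |S_t| <= n.  Expanding squares,
     n - sum_ij Y_ij,ij =
       sum_t (sum_(p in S_t) (u_t(p) - c_t)^2 + (n - |S_t|) c_t^2),
   where each summand is nonnegative.  Without an isomorphism |S_t| <= n - 1, so
   the objective is at most n - 1, and no compactness is needed to handle the
   supremum.  If the objective is n, all summands vanish, so every u_t is c_t
   times a permutation matrix of an isomorphism and Y is the convex combination
   of the P^[2] with weights c_t^2. *)
Require Import Defs.
From mathcomp Require Import all_boot all_order all_fingroup all_algebra.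
From mathcomp Require Import all_classical all_reals all_analysis.
From mathcomp Require Import ring lra.

Set Implicit Arguments.
Unset Strict Implicit.
Unset Printing Implicit Defensive.

Import Order.TTheory GRing.Theory Num.Theory.

Local Open Scope classical_set_scope.
Local Open Scope ring_scope.

Lemma perm_mx2E (R : realType) (n : nat) (s : 'S_n) (i j k l : 'I_n) :
  perm_mx2 R s (mxvec_index i j) (mxvec_index k l) =
  (s i == j)%:R * (s k == l)%:R.
Proof. by rewrite mxE !mxvecE /perm_mx !mxE. Qed.

Lemma drop_omegaE (R : realType) (n : nat) (Y : 'M[R]_(n * n + 1))
    (i j k l : 'I_n) :
  drop_omega Y (mxvec_index i j) (mxvec_index k l) =
  Y (pair_idx i j) (pair_idx k l).
Proof. by rewrite !mxE. Qed.

Lemma mxvec_index_ind (m n : nat) (P : 'I_(m * n) -> Prop) :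
  (forall i j, P (mxvec_index i j)) -> forall a, P a.
Proof. by move=> H a; case/mxvec_indexP: a. Qed.

(** * Lifting convex combinations of isomorphisms to feasible matrices *)

Section Factor.

Variables (R : realType) (n k : nat) (w : 'I_k -> R) (s : 'I_k -> 'S_n).
Hypotheses (w_ge0 : forall t, 0 <= w t) (w_sum1 : \sum_(t < k) w t = 1).

(** Column [t] is [Num.sqrt (w t)] times the vectorised permutation matrix of [s t] extended by a 1
    at omega, so its Gram matrix carries weight [w t]. *)
Definition iso_factor : 'M[R]_(n * n + 1, k) :=
  col_mx (\matrix_(a, t) (Num.sqrt (w t) * mxvec (perm_mx (s t) : 'M[R]_n) 0 a))
         (\matrix_(a, t) Num.sqrt (w t)).

Lemma iso_factor_pair (i j : 'I_n) (t : 'I_k) :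
  iso_factor (pair_idx i j) t = Num.sqrt (w t) * (s t i == j)%:R.
Proof. by rewrite col_mxEu mxE mxvecE /perm_mx !mxE. Qed.

Lemma iso_factor_omega (t : 'I_k) :
  iso_factor (omega_idx n) t = Num.sqrt (w t).
Proof. by rewrite col_mxEd mxE. Qed.

Let Y := iso_factor *m iso_factor^T.

Let Y_pair (i j i' j' : 'I_n) : Y (pair_idx i j) (pair_idx i' j') =
  \sum_t w t * ((s t i == j)%:R * (s t i' == j')%:R).
Proof.
rewrite mxE; apply: eq_bigr => t _; rewrite [_^T _ _]mxE !iso_factor_pair.
by rewrite mulrACA -expr2 sqr_sqrtr.
Qed.

Lemma iso_factor_drop : drop_omega Y = \sum_t w t *: perm_mx2 R (s t).
Proof.
apply/matrixP; elim/mxvec_index_ind => i j; elim/mxvec_index_ind => i' j'.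
rewrite drop_omegaE Y_pair summxE; apply: eq_bigr => t _.
by rewrite [in RHS]mxE perm_mx2E.
Qed.

Lemma iso_factor_objective : cplt_objective Y = n%:R.
Proof.
rewrite /cplt_objective.
transitivity (\sum_(i < n) (1 : R)); last by rewrite sumr_const card_ord.
apply: eq_bigr => i _; under eq_bigr do rewrite Y_pair.
rewrite exchange_big -[RHS]w_sum1; apply: eq_bigr => t _ /=.
rewrite (bigD1 (s t i)) //= eqxx !mulr1 big1 ?addr0 // => j.
by rewrite eq_sym => /negPf ->; rewrite mulr0 mulr0.
Qed.

Lemma iso_factor_feasible (E1 E2 : rel 'I_n) :
  (forall t, graph_isomorphism E1 E2 (s t)) -> cplt_feasible E1 E2 Y.
Proof.
move=> iso_s.
(* All four families of zero constraints say that no [s t] can send [i] to [j] and [i'] to [j'] at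
   once. *)
have vanish i j i' j' :
    (forall t, s t i = j -> s t i' = j' -> False) ->
    Y (pair_idx i j) (pair_idx i' j') = 0.
  move=> H; rewrite Y_pair big1 // => t _.
  case: eqP => [e1|]; last by rewrite mul0r mulr0.
  by case: eqP => [e2|]; [case: (H t e1 e2)|rewrite !mulr0].
split.
- split; first by rewrite trmx_mul trmxK.
  exists k, iso_factor; split=> //.
  rewrite /iso_factor => a t; rewrite mxE; case: fintype.split => b; rewrite mxE.
    by elim/mxvec_index_ind: b => i j; rewrite mxvecE /perm_mx !mxE mulr_ge0 ?sqrtr_ge0.
  exact: sqrtr_ge0.
- rewrite mxE -[RHS]w_sum1; apply: eq_bigr => t _.
  by rewrite [_^T _ _]mxE iso_factor_omega -expr2 sqr_sqrtr.
- move=> i j; rewrite Y_pair mxE; apply: eq_bigr => t _.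
  rewrite [_^T _ _]mxE iso_factor_pair iso_factor_omega mulrAC -expr2 sqr_sqrtr //.
  by rewrite -natrM mulnb andbb.
- by move=> i j l /eqP jl; apply: vanish => t sj sl; apply: jl; rewrite -sj.
- by move=> i j l /eqP jl; apply: vanish => t sj sl; apply/jl/(@perm_inj _ (s t)); rewrite sj.
- by move=> i j i' j' e1 e2; apply: vanish => t sj sj'; move: e2;
    rewrite -sj -sj' iso_s e1.
- by move=> i j i' j' e1 e2; apply: vanish => t sj sj'; move: e1;
    rewrite -(iso_s t) sj sj' e2.
Qed.

End Factor.

(** * Partial isomorphisms as sets of pairs *)

Section Support.

Variables (n : nat) (E1 E2 : rel 'I_n) (S : {set 'I_n * 'I_n}).

Definition partial_isomorphism : Prop :=
  forall p q, p \in S -> q \in S ->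
    (p.1 == q.1) = (p.2 == q.2) /\ E2 p.2 q.2 = E1 p.1 q.1.

Hypothesis pisoS : partial_isomorphism.

Lemma partial_isomorphism_inj1 : {in S &, injective fst}.
Proof.
move=> p q pS qS e; have [] := pisoS pS qS; rewrite e eqxx => /esym/eqP e2 _.
by rewrite [p]surjective_pairing [q]surjective_pairing e e2.
Qed.

Lemma partial_isomorphism_card : (#|S| <= n)%N.
Proof.
rewrite -(card_in_imset partial_isomorphism_inj1) -[leqRHS]card_ord.
exact: max_card.
Qed.

(** The first projection is injective on [S], so [n] pairs reach every vertex and [S] is the graph
    of a total injective map, hence of a permutation. *)
Lemma partial_isomorphism_full : #|S| = n ->
  exists2 s : 'S_n, graph_isomorphism E1 E2 s &
    forall i j, ((i, j) \in S) = (s i == j).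
Proof.
move=> cardS.
have imS : (fst @: S = [set: 'I_n])%SET.
  apply/eqP; rewrite eqEcard finset.subsetT /= cardsT card_ord.
  by rewrite (card_in_imset partial_isomorphism_inj1) cardS.
have exf i : exists j, (i, j) \in S.
  have : i \in (fst @: S)%SET by rewrite imS finset.in_setT.
  by case/imsetP => -[i' j] pS /= ->; exists j.
have [f fS] := choice exf.
have f_inj : injective f.
  move=> i i' e; have [/= + _] := pisoS (fS i) (fS i').
  by rewrite e eqxx => /eqP.
exists (perm f_inj) => [x y|i j]; rewrite !permE.
  by have [/= _ ->] := pisoS (fS x) (fS y).
apply/idP/eqP => [ijS|<- //].
by have [/= + _] := pisoS (fS i) ijS; rewrite eqxx => /esym/eqP.
Qed.

End Support.

(** * Column-by-column accounting of the gap between [n] and the objective *)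

Section Deficit.

Variables (R : realType) (n k : nat) (E1 E2 : rel 'I_n).
Variables (Q : 'M[R]_(n * n + 1, k)).
Hypotheses (Q_ge0 : forall a t, 0 <= Q a t).
Hypothesis feasQ : cplt_feasible E1 E2 (Q *m Q^T).

Local Notation entry p t := (Q (pair_idx p.1 p.2) t).
Local Notation c t := (Q (omega_idx n) t).

Definition column_support (t : 'I_k) : {set 'I_n * 'I_n} :=
  [set p | entry p t != 0]%SET.

Let mulQE a b : (Q *m Q^T) a b = \sum_t Q a t * Q b t.
Proof. by rewrite mxE; apply: eq_bigr => t _; rewrite mxE. Qed.

(** A vanishing sum of nonnegative products vanishes termwise; this turns the zero constraints on
    the matrix into constraints on each column. *)
Let Q_orth a b t : (Q *m Q^T) a b = 0 -> Q a t = 0 \/ Q b t = 0.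
Proof.
rewrite mulQE => /eqP; rewrite psumr_eq0 => [/allP/(_ t)|i _]; last exact: mulr_ge0.
by rewrite mem_index_enum mulf_eq0 => /(_ isT) /orP[]/eqP; [left|right].
Qed.

Lemma column_support_piso (t : 'I_k) :
  partial_isomorphism E1 E2 (column_support t).
Proof.
move=> [i j] [i' j']; rewrite !inE /= => /eqP nz /eqP nz'.
have nY : (Q *m Q^T) (pair_idx i j) (pair_idx i' j') <> 0.
  by move=> /(Q_orth t)[].
split.
  apply/eqP/eqP => e; subst; apply/eqP/negPn/negP => ne; apply: nY.
    exact: (cplt_row feasQ).
  exact: (cplt_col feasQ).
apply/idP/idP => e; apply/negPn/negP => ne; apply: nY.
  exact: (cplt_nonedge feasQ).
exact: (cplt_edge feasQ).
Qed.

Lemma sum_omega_sqr : \sum_t c t ^+ 2 = 1.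
Proof.
by rewrite -(cplt_omega feasQ) mulQE; apply: eq_bigr => t _; rewrite expr2.
Qed.

Definition deficit (t : 'I_k) : R :=
  \sum_(p in column_support t) (entry p t - c t) ^+ 2
  + (n - #|column_support t|)%:R * c t ^+ 2.

(* With [V] the objective, the constraint [Y_{ij,omega} = Y_{ij,ij}] makes the
   squares expand to [V - 2 V + sum_t |S_t| c_t^2]. *)
Lemma sum_deficit :
  \sum_t deficit t = n%:R - cplt_objective (Q *m Q^T).
Proof.
(* Off the support the entries are 0, so the terms containing an entry may run over all pairs; only
   the square of [c t] has to be counted on the support. *)
have supp t : \sum_(p in column_support t) (entry p t - c t) ^+ 2 =
    \sum_p (entry p t * entry p t - 2 * (entry p t * c t))
    + #|column_support t|%:R * c t ^+ 2.
  rewrite (bigID (mem (column_support t)) predT) /=.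
  rewrite [X in _ = _ + X + _]big1 ?addr0 => [|p]; last first.
    by rewrite inE negbK => /eqP ->; rewrite !mul0r mulr0 subr0.
  rewrite mulr_natl -sumr_const -big_split /=.
  by apply: eq_bigr => p _; ring.
have -> : \sum_t deficit t =
    \sum_p \sum_t (entry p t * entry p t - 2 * (entry p t * c t))
    + n%:R * \sum_t c t ^+ 2.
  rewrite exchange_big mulr_sumr -big_split /=; apply: eq_bigr => t _.
  (* The truncated subtraction in [deficit] is exact because the support has at most [n] pairs. *)
  rewrite /deficit supp natrB; first by ring.
  exact: partial_isomorphism_card (@column_support_piso t).
rewrite sum_omega_sqr mulr1 addrC; congr (_ + _).
rewrite [cplt_objective _]pair_bigA -sumrN; apply: eq_bigr => p _.
rewrite sumrB -mulr_sumr -!mulQE (cplt_diag feasQ); ring.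
Qed.

Lemma deficit_ge0 (t : 'I_k) : 0 <= deficit t.
Proof.
apply: addr_ge0; first by apply: sumr_ge0 => p _; exact: sqr_ge0.
by rewrite mulr_ge0 ?sqr_ge0.
Qed.

Lemma factor_objective_le : cplt_objective (Q *m Q^T) <= n%:R.
Proof. by rewrite -subr_ge0 -sum_deficit sumr_ge0 // => t _; exact: deficit_ge0. Qed.

(** Without an isomorphism no support is full, so column [t] has deficit at least [c t ^+ 2], and
    these squares sum to 1. *)
Lemma factor_objective_gap : ~ graph_isomorphic E1 E2 ->
  cplt_objective (Q *m Q^T) <= n%:R - 1.
Proof.
move=> niso; rewrite lerBrDr addrC -lerBrDr -sum_deficit -sum_omega_sqr.
apply: ler_sum => t _.
have piso := @column_support_piso t.
have lt_n : (#|column_support t| < n)%N.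
  rewrite ltn_neqAle (partial_isomorphism_card piso) andbT.
  by apply/eqP => /(partial_isomorphism_full piso)[s iso_s _]; apply: niso; exists s.
rewrite -[leLHS]add0r lerD //.
  by apply: sumr_ge0 => p _; exact: sqr_ge0.
by rewrite ler_peMl ?sqr_ge0 // (ler_nat _ 1) subn_gt0.
Qed.

Lemma factor_objective_eq : cplt_objective (Q *m Q^T) = n%:R ->
  iso_polytope R E1 E2 (drop_omega (Q *m Q^T)).
Proof.
move=> obj.
have def0 t : deficit t = 0.
  have /eqP : \sum_t deficit t = 0 by rewrite sum_deficit obj subrr.
  rewrite psumr_eq0 => [/allP/(_ t)|u _]; last exact: deficit_ge0.
  by rewrite mem_index_enum => /(_ isT) /eqP.
have entry_supp t p : p \in column_support t -> entry p t = c t.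
  move=> pS; move/eqP: (def0 t); rewrite paddr_eq0; first last.
  - by rewrite mulr_ge0 ?sqr_ge0.
  - by apply: sumr_ge0 => q _; exact: sqr_ge0.
  case/andP => + _; rewrite psumr_eq0 => [/allP/(_ p)|q _]; last exact: sqr_ge0.
  by rewrite mem_index_enum pS /= sqrf_eq0 subr_eq0 => /(_ isT) /eqP.
have entry_iso t : c t != 0 -> exists2 s : 'S_n, graph_isomorphism E1 E2 s &
    forall i j, Q (pair_idx i j) t = c t * (s i == j)%:R.
  move=> ct; have piso := @column_support_piso t.
  (* The second term of the zero deficit vanishes, and [c t] is nonzero, so no pair is missing. *)
  have cardS : #|column_support t| = n.
    apply/eqP; rewrite eqn_leq (partial_isomorphism_card piso) /= -subn_eq0.
    move/eqP: (def0 t); rewrite paddr_eq0; first last.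
    - by rewrite mulr_ge0 ?sqr_ge0.
    - by apply: sumr_ge0 => q _; exact: sqr_ge0.
    by case/andP => _; rewrite mulf_eq0 sqrf_eq0 (negPf ct) orbF pnatr_eq0.
  have [s iso_s suppE] := partial_isomorphism_full piso cardS.
  exists s => // i j; rewrite -suppE.
  case: (boolP ((i, j) \in _)) => [/entry_supp -> |]; first by rewrite mulr1.
  by rewrite inE negbK mulr0 => /eqP.
(* Columns with [c t = 0] have weight 0 but still need some isomorphism; one exists since the
   squares sum to 1 and cannot all vanish. *)
have [s0 iso_s0] : graph_isomorphic E1 E2.
  have [[t /entry_iso[s iso_s _]]|c0] := pselect (exists t, c t != 0); first by exists s.
  have := sum_omega_sqr; rewrite big1 => [/esym/eqP|t _]; first by rewrite oner_eq0.
  by apply/eqP; rewrite sqrf_eq0; apply/negPn/negP => ct; apply: c0; exists t.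
have exs t : exists s : 'S_n, graph_isomorphism E1 E2 s /\
    forall i j, Q (pair_idx i j) t = c t * (s i == j)%:R.
  have [ct|/entry_iso[s]] := eqVneq (c t) 0; last by exists s.
  exists s0; split=> // i j; rewrite ct mul0r.
  case: (boolP ((i, j) \in column_support t)) => [/entry_supp -> //|].
  by rewrite inE negbK => /eqP.
have [s sP] := choice exs.
exists k, (fun t => perm_mx2 R (s t)), (fun t => c t ^+ 2); split.
- by move=> t; exists (s t) => //; have [] := sP t.
- by move=> t; exact: sqr_ge0.
- exact: sum_omega_sqr.
apply/matrixP; elim/mxvec_index_ind => i j; elim/mxvec_index_ind => i' j'.
rewrite drop_omegaE mulQE summxE; apply: eq_bigr => t _.
rewrite [RHS]mxE perm_mx2E; have [_ QE] := sP t.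
by rewrite !QE; ring.
Qed.

End Deficit.

(** * The optimal value and the set of optimal points *)

Section Feasible.

Variables (R : realType) (n : nat) (E1 E2 : rel 'I_n).

Lemma cplt_objective_le (Y : 'M[R]_(n * n + 1)) :
  cplt_feasible E1 E2 Y -> cplt_objective Y <= n%:R.
Proof.
move=> feas; have [_ [k [Q [Q_ge0 YE]]]] := cplt_cp feas.
by subst Y; exact: factor_objective_le feas.
Qed.

Lemma cptheta_isomorphic :
  graph_isomorphic E1 E2 -> cptheta R E1 E2 = n%:R%:E.
Proof.
move=> [s iso_s]; apply/eqP; rewrite eq_le; apply/andP; split.
  by apply: ge_ereal_sup => _ [Y feas <-]; rewrite lee_fin cplt_objective_le.
(* The lift of a single isomorphism, with weight 1, attains the upper bound. *)
pose w := fun _ : 'I_1 => 1 : R.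
have w_sum1 : \sum_t w t = 1 by rewrite big_ord1.
rewrite -(iso_factor_objective (fun=> s) (fun=> ler01) w_sum1).
apply: ereal_sup_ubound; eexists; last reflexivity.
exact: iso_factor_feasible.
Qed.

Lemma isomorphic_cptheta :
  cptheta R E1 E2 = n%:R%:E -> graph_isomorphic E1 E2.
Proof.
move=> thetaE; apply: contrapT => niso.
have : (cptheta R E1 E2 <= (n%:R - 1)%:E)%E.
  apply: ge_ereal_sup => _ [Y feas <-]; rewrite lee_fin.
  have [_ [k [Q [Q_ge0 YE]]]] := cplt_cp feas.
  by subst Y; exact: (factor_objective_gap Q_ge0 feas).
by rewrite thetaE lee_fin; lra.
Qed.

Lemma cplt_optimal_polytope : cptheta R E1 E2 = n%:R%:E ->
  [set drop_omega Y | Y in cplt_optimal R E1 E2] = iso_polytope R E1 E2.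
Proof.
move=> thetaE; apply/seteqP; split=> [_ [Y [feas +] <-]|X].
  rewrite thetaE => -[obj]; have [_ [k [Q [Q_ge0 YE]]]] := cplt_cp feas.
  by subst Y; exact: (factor_objective_eq Q_ge0 feas).
move=> [k [v [w [vP w_ge0 w_sum1 ->]]]].
have /choice[s sP] : forall t, exists s : 'S_n,
    graph_isomorphism E1 E2 s /\ perm_mx2 R s = v t.
  by move=> t; have [s ? ?] := vP t; exists s.
(* The factor restores the omega row and column above a given point of the polytope. *)
exists (iso_factor w s *m (iso_factor w s)^T); last first.
  by rewrite iso_factor_drop //; apply: eq_bigr => t _; have [_ ->] := sP t.
split; first by apply: iso_factor_feasible => // t; have [] := sP t.
by rewrite thetaE iso_factor_objective.
Qed.

End Feasible.

Theorem lemma5 (R : realType) (n : nat) (E1 E2 : rel 'I_n)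
    (symE1 : symmetric E1) (irrE1 : irreflexive E1)
    (symE2 : symmetric E2) (irrE2 : irreflexive E2) :
  (cptheta R E1 E2 = n%:R%:E <-> graph_isomorphic E1 E2) /\
  (cptheta R E1 E2 = n%:R%:E ->
   [set drop_omega Y | Y in cplt_optimal R E1 E2] = iso_polytope R E1 E2).
Proof.
split; last exact: cplt_optimal_polytope.
by split; [exact: isomorphic_cptheta|exact: cptheta_isomorphic].
Qed.
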